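(* Permutations avoiding $1\text{-}23\text{-}4$ grow according to the following succession rule: \[\Omega_{1\text{-}23\text{-}4}=\left\{\begin{array}{ll}(1,1)&\\ (1,k)\rightsquigarrow (1,k+1),(2,k),\ldots,(1+k,1),&\\ (h,k)\rightsquigarrow (1,h+k),(2,h+k-1),\ldots,(h,k+1),\ (h+1,0),\ldots,(h+k,0),&\text{if } h\neq 1.\end{array}\right.\]
   Context: A permutation $\pi=\pi_1\cdots\pi_n$ of $\{1,\ldots,n\}$ (size $n\ge1$) contains the vincular pattern $1\text{-}23\text{-}4$ if there are indices $j<i$ and $k>i+1$ with $\pi_j<\pi_i<\pi_{i+1}<\pi_k$; otherwise it avoids $1\text{-}23\text{-}4$. A generating tree for a combinatorial class $\mathcal{C}$ (with finitely many objects of each size and exactly one object of size $1$) is an infinite rooted tree whose vertices are the objects of $\mathcal{C}$, each appearing exactly once, with objects of size $n$ at level $n$ (the root being at level $1$); the children of an object $c$ are obtained by adding to $c$ an atom (a piece of object increasing the size by $1$) following some prescribed rules. A succession rule consists of a starting label (the axiom) and, for each label, a multiset of produced labels (its productions). The class $\mathcal{C}$ grows according to a succession rule $\Omega$ if there are a generating tree for $\mathcal{C}$ and an assignment of labels to the objects of $\mathcal{C}$ such that the root carries the axiom and, for each object with label $\ell$, the multiset of labels of its children is exactly the multiset of productions of $\ell$ in $\Omega$. In the rule above, the axiom is $(1,1)$; label $(1,k)$ produces $(i,k+2-i)$ once for each $1\le i\le k+1$; label $(h,k)$ with $h\ne1$ produces $(i,h+k+1-i)$ once for each $1\le i\le h$,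 and $(h+i,0)$ once for each $1\le i\le k$. *)

(* Defs.v *)
From mathcomp Require Import all_boot all_fingroup.

Set Implicit Arguments.
Unset Strict Implicit.
Unset Printing Implicit Defensive.

(* [obj n] is the type of objects of size n; only the sizes n >= 1 matter.    *)
(* [adds_atom c d] says that d is c with one atom added.                      *)
Record comb_class := CombClass {
  obj : nat -> finType;
  adds_atom : forall n, obj n -> obj n.+1 -> Prop;
  card_obj1 : #|obj 1| = 1
}.

(* A tree on all the objects of size >= 1, with size as level, is given by    *)
(* the parent of each object of size >= 2; the root is the object of size 1.  *)
(* Levels are finite and each vertex of level n.+2 has a parent, so the tree  *)
(* is infinite exactly when no level is empty.                                *)
Record gen_tree (C : comb_class) := GenTree {
  parent : forall n, obj C n.+2 -> obj C n.+1;
  parent_adds_atom : forall n (d : obj C n.+2), adds_atom (parent d) d;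
  gen_tree_infinite : forall n, 0 < #|obj C n.+1|
}.

Definition children (C : comb_class) (t : gen_tree C) n (c : obj C n.+1) :
    {set obj C n.+2} :=
  [set d | parent t d == c].

(* Productions form a multiset: a sequence, compared up to [perm_eq].         *)
Record succession_rule (L : eqType) := SuccessionRule {
  rule_axiom : L;
  productions : L -> seq L
}.

Definition grows_according_to (C : comb_class) (L : eqType)
    (Omega : succession_rule L) : Prop :=
  exists (t : gen_tree C) (label : forall n, obj C n.+1 -> L),
    (forall root : obj C 1, label 0 root = rule_axiom Omega) /\
    (forall n (c : obj C n.+1),
       perm_eq [seq label n.+1 d | d in children t c]
               (productions Omega (label n c))).

(* Positions and values run over {0, ..., n-1} rather than {1, ..., n}.       *)
Definition contains_1_23_4 n (s : 'S_n) : bool :=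
  [exists j : 'I_n, exists i : 'I_n, exists i' : 'I_n, exists k : 'I_n,
     [&& j < i, i' == i.+1 :> nat, i' < k,
         s j < s i, s i < s i' & s i' < s k]].

Definition av_1_23_4 n : finType := {s : 'S_n | ~~ contains_1_23_4 s}.

(* [lift_perm i j s] inserts in the one-line notation of s a new entry at     *)
(* position i with value j, the values >= j of s being raised by one.         *)
Definition adds_entry n (c : av_1_23_4 n) (d : av_1_23_4 n.+1) : Prop :=
  exists i j : 'I_n.+1, val d = lift_perm i j (val c).

Lemma card_av_1_23_4_1 : #|av_1_23_4 1| = 1.
Proof.
have av1 : ~~ contains_1_23_4 (1%g : 'S_1).
  apply/existsP=> -[j /existsP[i /existsP[i' /existsP[k /and3P[ji _ _]]]]].
  by rewrite !ord1 in ji.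
pose r : av_1_23_4 1 := exist (fun s : 'S_1 => ~~ contains_1_23_4 s) _ av1.
apply: etrans (card1 r); apply: eq_card => x.
rewrite !inE; symmetry; apply/eqP/val_inj/permP=> i.
by rewrite (ord1 (val x i)) (ord1 (_ i)).
Qed.

Definition Av_1_23_4 : comb_class :=
  @CombClass av_1_23_4 adds_entry card_av_1_23_4_1.

Definition productions_1_23_4 (l : nat * nat) : seq (nat * nat) :=
  let: (h, k) := l in
  if h == 1 then [seq (i, k + 2 - i) | i <- iota 1 k.+1]
  else [seq (i, h + k + 1 - i) | i <- iota 1 h]
       ++ [seq (h + i, 0) | i <- iota 1 k].

Definition Omega_1_23_4 : succession_rule (nat * nat)%type :=
  SuccessionRule (1, 1) productions_1_23_4.

(* Main.v *)
Require Import Defs.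
From mathcomp Require Import all_boot all_fingroup.
From mathcomp Require Import zify.

(** Permutations grow here by a new last entry. Deleting the last entry of an
    avoider of 1-23-4 destroys no adjacency, so it leaves an avoider, and this
    gives the parent of a vertex. Conversely, a new last entry of value a makes
    an avoider s contain the pattern exactly when it plays the role of the 4,
    that is when s has an occurrence of 1-23 all of whose values lie below a.
    The admissible values a thus form an initial segment {0, ..., A - 1}, and
    its length A ([num_sites]) together with the last value l of s determines
    everything. Indeed, let s' be s followed by a, with a < A.
    - If 0 < l < a, then some entry smaller than l precedes l, so l and a form
      the 23 of a new occurrence of 1-23, of top a. No occurrence has a lower
      top since a is admissible, and hence s' has exactly a + 1 admissible
      values.
    - Otherwise l is the minimum of s or l, a is a descent; no occurrence of
      1-23 is created, those of s have their tops raised by one, and s' has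
      A + 1 admissible values.
    These two cases are [num_sites_rcons]. With the label (h, k) in which
    h = l + 1 counts the admissible values that are at most l and k = A - h
    those above l, they are the productions of the rule: the case h = 1 is
    l = 0, and the labels (h + i, 0) come from the values above l > 0. *)

Set Implicit Arguments.
Unset Strict Implicit.
Unset Printing Implicit Defensive.

(** * Appending a last entry to a permutation *)

Definition rcons_perm n (a : 'I_n.+1) (s : 'S_n) : 'S_n.+1 :=
  lift_perm ord_max a s.

Lemma rcons_perm_max n (a : 'I_n.+1) (s : 'S_n) : rcons_perm a s ord_max = a.
Proof. exact: lift_perm_id. Qed.

Lemma rcons_perm_lift n (a : 'I_n.+1) (s : 'S_n) (i : 'I_n) :
  rcons_perm a s (lift ord_max i) = bump a (s i) :> nat.
Proof. by rewrite /rcons_perm lift_perm_lift. Qed.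

Lemma rcons_perm_inj n (a : 'I_n.+1) : injective (@rcons_perm n a).
Proof.
move=> s t est; apply/permP=> i; apply: (@lift_inj _ a).
by rewrite -!(lift_perm_lift ord_max) -/(rcons_perm a s) est.
Qed.

Lemma rcons_perm_surj n (d : 'S_n.+1) : {s | d = rcons_perm (d ord_max) s}.
Proof.
have dlift i : d (lift ord_max i) = lift (d ord_max)
    (odflt i (unlift (d ord_max) (d (lift ord_max i)))).
  by case: unliftP => [//|/perm_inj/eqP]; rewrite eq_sym (negPf (neq_lift _ _)).
have inj : injective
    (fun i => odflt i (unlift (d ord_max) (d (lift ord_max i)))).
  by move=> i j /= eij; apply: (@lift_inj _ ord_max); apply: (@perm_inj _ d);
    rewrite (dlift i) (dlift j) eij.
exists (perm inj); apply/permP=> i; rewrite /rcons_perm.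
case: (unliftP ord_max i) => [j|] ->; last by rewrite lift_perm_id.
by rewrite lift_perm_lift permE; exact: dlift.
Qed.

Definition belast_perm n (d : 'S_n.+1) : 'S_n := sval (rcons_perm_surj d).

Lemma belast_permK n (d : 'S_n.+1) :
  rcons_perm (d ord_max) (belast_perm d) = d.
Proof. by rewrite -(svalP (rcons_perm_surj d)). Qed.

Lemma rcons_permK n (a : 'I_n.+1) (s : 'S_n) :
  belast_perm (rcons_perm a s) = s.
Proof.
by apply: (@rcons_perm_inj _ a);
   rewrite -[RHS]belast_permK rcons_perm_max.
Qed.

Lemma ltn_bump2 a x y : (bump a x < bump a y) = (x < y).
Proof. by rewrite ltnNge leq_bump2 -ltnNge. Qed.

Lemma bump_ltn a x : (bump a x < a) = (x < a).
Proof. by rewrite /bump; lia. Qed.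

(** * Occurrences of 1-23 and admissible last values *)

(** The obstruction to a new last entry of value a, which would be the 4. *)
Definition has_1_23_below n (s : 'S_n) (a : nat) : bool :=
  [exists j : 'I_n, exists i : 'I_n, exists i' : 'I_n,
     [&& j < i, i' == i.+1 :> nat, s j < s i, s i < s i' & s i' < a]].

Lemma has_1_23_belowP n (s : 'S_n) a :
  reflect (exists j i i' : 'I_n,
             [/\ j < i, i' = i.+1 :> nat, s j < s i, s i < s i' & s i' < a])
          (has_1_23_below s a).
Proof.
apply: (iffP existsP) => [[j /existsP[i /existsP[i']]]|[j [i [i']]]].
  by case/and5P=> ? /eqP ? ? ? ?; exists j, i, i'.
case=> *; exists j; apply/existsP; exists i; apply/existsP; exists i'.
by apply/and5P; split=> //; apply/eqP.
Qed.

Lemma contains_1_23_4P n (s : 'S_n) :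
  reflect (exists j i i' k : 'I_n, [/\ j < i, i' = i.+1 :> nat & i' < k] /\
             [/\ s j < s i, s i < s i' & s i' < s k])
          (contains_1_23_4 s).
Proof.
apply: (iffP existsP) => [[j /existsP[i /existsP[i' /existsP[k]]]]|].
  by case/and5P=> ? /eqP ? ? ? /andP[? ?]; exists j, i, i', k.
case=> j [i [i' [k [[? ? ?] [? ? ?]]]]]; exists j; apply/existsP; exists i.
apply/existsP; exists i'; apply/existsP; exists k.
by apply/and5P; split=> //; [apply/eqP | apply/andP].
Qed.

Lemma has_1_23_below_homo n (s : 'S_n) a b :
  a <= b -> has_1_23_below s a -> has_1_23_below s b.
Proof.
move=> ab /has_1_23_belowP[j [i [i' [? ? ? ? sa]]]].
by apply/has_1_23_belowP; exists j, i, i'; split=> //; exact: leq_trans ab.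
Qed.

(** A 1-23 needs three values below a. *)
Lemma has_1_23_below_small n (s : 'S_n) a : a <= 1 -> ~~ has_1_23_below s a.
Proof.
by move=> a1; apply/negP=> /has_1_23_belowP[j [i [i' [? ? ? ? ?]]]]; lia.
Qed.

Lemma contains_rcons_perm n (a : 'I_n.+1) (s : 'S_n) :
  contains_1_23_4 (rcons_perm a s) = contains_1_23_4 s || has_1_23_below s a.
Proof.
apply/contains_1_23_4P/orP.
  case=> j [i [i' [k [[]]]]].
  (* Only k may be the new position, since j, i and i' precede k. *)
  case: (unliftP ord_max j) => [{}j|] ->;
    last by have := ltn_ord i; move=> /=; lia.
  case: (unliftP ord_max i) => [{}i|] ->;
    last by have := ltn_ord i'; move=> /=; lia.
  case: (unliftP ord_max i') => [{}i'|] ->;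
    last by have := ltn_ord k; move=> /=; lia.
  rewrite !rcons_perm_lift !lift_max !ltn_bump2 => ji ii'.
  case: (unliftP ord_max k) => [{}k|] -> i'k [sji sii'].
    rewrite rcons_perm_lift ltn_bump2 => si'k; left.
    rewrite lift_max in i'k.
    by apply/contains_1_23_4P; exists j, i, i', k.
  rewrite rcons_perm_max bump_ltn => si'a; right.
  by apply/has_1_23_belowP; exists j, i, i'.
case=> [/contains_1_23_4P[j [i [i' [k [[? ? ?] [? ? ?]]]]]]|].
  exists (lift ord_max j), (lift ord_max i), (lift ord_max i'), (lift ord_max k).
  by rewrite !rcons_perm_lift !lift_max !ltn_bump2.
case/has_1_23_belowP=> j [i [i' [? ? ? ? ?]]].
exists (lift ord_max j), (lift ord_max i), (lift ord_max i'), ord_max.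
by rewrite !rcons_perm_lift !lift_max !ltn_bump2 rcons_perm_max bump_ltn /=.
Qed.

(** An occurrence of 1-23 in s followed by a either uses a, and then the last
    two entries l, a are its 23 while 0 < l provides the 1; or it comes from
    s, and then its top was at least a, because a is admissible, and has been
    raised by one. Its top is thus at least a in both cases. *)
Lemma has_1_23_below_rcons n (a : 'I_n.+2) (s : 'S_n.+1) b :
  ~~ has_1_23_below s a ->
  has_1_23_below (rcons_perm a s) b =
    (a < b) && ((0 < s ord_max < a) || has_1_23_below s b.-1).
Proof.
move=> nsa; apply/has_1_23_belowP/idP.
  case=> j [i [i' [ji ii']]].
  case: (unliftP ord_max j) ji => [{}j|] -> ji;
    last by move: ji (ltn_ord i) => /=; lia.
  case: (unliftP ord_max i) ji ii' => [{}i|] -> ji ii';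
    last by move: ii' (ltn_ord i') => /=; lia.
  case: (unliftP ord_max i') ii' => [{}i'|] -> ii'.
    rewrite !rcons_perm_lift !lift_max !ltn_bump2 in ji ii' * => sji sii' si'b.
    have asi : a <= s i'.
      rewrite leqNgt; apply: contra nsa => si'a.
      by apply/has_1_23_belowP; exists j, i, i'.
    rewrite /bump asi in si'b.
    apply/andP; split; first lia.
    by apply/orP; right; apply/has_1_23_belowP; exists j, i, i'; split=> //; lia.
  have -> : i = ord_max by apply/val_inj; move: ii'; rewrite lift_max /=; lia.
  rewrite !rcons_perm_lift rcons_perm_max ltn_bump2 => sji.
  by rewrite bump_ltn => sia ->; rewrite sia andbT (leq_ltn_trans _ sji).
case/andP=> ab /orP[/andP[s0 sa]|].
  (* The 1 is the minimum of s, which cannot be in last position as 0 < l. *)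
  have [j sj] : exists j, s j = ord0 by exists (s^-1%g ord0); rewrite permKV.
  exists (lift ord_max j), (lift ord_max ord_max), ord_max.
  rewrite !rcons_perm_lift rcons_perm_max !lift_max ltn_bump2 bump_ltn sj.
  split=> //; rewrite ltn_neqAle -ltnS ltn_ord andbT.
  by apply: contraTneq s0 => /val_inj <-; rewrite sj.
case/has_1_23_belowP=> j [i [i' [ji ii' sji sii' sb]]].
exists (lift ord_max j), (lift ord_max i), (lift ord_max i').
rewrite !rcons_perm_lift !lift_max !ltn_bump2; split=> //.
by rewrite /bump; case: leqP; lia.
Qed.

(** The first obstructed value, capped at the n + 1 values possible for a new
    last entry; obstruction being monotone, this is the number of admissible
    values. *)
Definition num_sites n (s : 'S_n) : nat :=
  find (has_1_23_below s) (iota 0 n.+1).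

Lemma num_sitesP n (s : 'S_n) b :
  b <= n -> has_1_23_below s b = (num_sites s <= b).
Proof.
move=> bn; apply/idP/idP => [sb|].
  by rewrite leqNgt; apply/negP=> /(before_find 0); rewrite nth_iota ?sb.
move=> nb; apply: (has_1_23_below_homo nb).
have lt_sz : num_sites s < size (iota 0 n.+1).
  by rewrite size_iota ltnS (leq_trans nb).
have := lt_sz; rewrite /num_sites -has_find => /(nth_find 0).
by rewrite nth_iota // -[X in _ < X](size_iota 0 n.+1).
Qed.

Lemma num_sites_max n (s : 'S_n) : num_sites s <= n.+1.
Proof. by rewrite -[leqRHS](size_iota 0 n.+1) find_size. Qed.

Lemma num_sites_uniq n (s : 'S_n) T :
  T <= n.+1 -> (forall b, b <= n -> has_1_23_below s b = (T <= b)) ->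
  num_sites s = T.
Proof.
move=> Tn sT; have nn := num_sites_max s.
have agree b : b <= n -> (num_sites s <= b) = (T <= b).
  by move=> bn; rewrite -num_sitesP ?sT.
case: (ltngtP (num_sites s) T) => // lt.
  by have := agree (num_sites s); lia.
by have := agree T; lia.
Qed.

Lemma num_sites_rcons n (a : 'I_n.+2) (s : 'S_n.+1) :
  a < num_sites s ->
  num_sites (rcons_perm a s) =
    if 0 < s ord_max < a then a.+1 else (num_sites s).+1.
Proof.
move=> aA; have an : a <= n.+1 by rewrite -ltnS.
have nsa : ~~ has_1_23_below s a by rewrite num_sitesP // -ltnNge.
apply: num_sites_uniq => [|b bn].
  by case: ifP => _; rewrite ltnS ?num_sites_max // ltnW.
rewrite has_1_23_below_rcons //; case: ifP => _ /=; first by rewrite andbT.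
by rewrite num_sitesP; lia.
Qed.

(** A 1-23 below the last value cannot use the last position, so it would
    extend to a 1-23-4 ending there. *)
Lemma last_lt_num_sites n (s : 'S_n.+1) :
  ~~ contains_1_23_4 s -> s ord_max < num_sites s.
Proof.
move=> av; rewrite ltnNge -num_sitesP; last by rewrite ltnW.
apply: contra av => /has_1_23_belowP[j [i [i' [? ? ? ? sl]]]].
apply/contains_1_23_4P; exists j, i, i', ord_max; split; split=> //.
rewrite ltn_neqAle -ltnS ltn_ord andbT.
by apply: contraTneq sl => /val_inj ->; rewrite ltnn.
Qed.

(** * The generating tree *)

Definition av_intro n (s : 'S_n) (avs : ~~ contains_1_23_4 s) : av_1_23_4 n :=
  exist (fun s : 'S_n => ~~ contains_1_23_4 s) s avs.

Lemma rcons_perm_avoids n (a : 'I_n.+1) (c : av_1_23_4 n) :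
  (~~ contains_1_23_4 (rcons_perm a (val c))) = (a < num_sites (val c)).
Proof.
rewrite contains_rcons_perm (negPf (valP c)) /= num_sitesP ?ltnNge //.
by rewrite -ltnS.
Qed.

Lemma belast_perm_avoids n (d : av_1_23_4 n.+1) :
  ~~ contains_1_23_4 (belast_perm (val d)).
Proof.
have := valP d; rewrite -{1}(belast_permK (val d)) contains_rcons_perm.
by case/norP.
Qed.

Definition av_parent n (d : av_1_23_4 n.+1) : av_1_23_4 n :=
  av_intro (belast_perm_avoids d).

Lemma av_parent_adds_entry n (d : av_1_23_4 n.+1) : adds_entry (av_parent d) d.
Proof. by exists ord_max, (val d ord_max); rewrite [RHS]belast_permK. Qed.

(** The value 0 is always admissible, so no level is empty. *)
Lemma av_inhabited n : 0 < #|av_1_23_4 n.+1|.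
Proof.
elim: n => [|n /card_gt0P[c _]]; first by rewrite card_av_1_23_4_1.
have avd : ~~ contains_1_23_4 (rcons_perm ord0 (val c)).
  by rewrite contains_rcons_perm negb_or (valP c) has_1_23_below_small.
by apply/card_gt0P; exists (av_intro avd).
Qed.

Definition av_tree : gen_tree Av_1_23_4 :=
  @GenTree Av_1_23_4 (fun n => @av_parent n.+1)
    (fun n => @av_parent_adds_entry n.+1) av_inhabited.

Definition av_label n (c : av_1_23_4 n.+1) : nat * nat :=
  let h := (val c ord_max).+1 in (h, num_sites (val c) - h).

Lemma av_parentE n (c : av_1_23_4 n) (d : av_1_23_4 n.+1) :
  av_parent d = c -> val d = rcons_perm (val d ord_max) (val c).
Proof. by move=> <-; rewrite /= belast_permK. Qed.

(** A child is determined by its last value, and the possible last values are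
    the admissible ones; this turns the multiset of children into a list. *)
Lemma perm_last_children n (c : av_1_23_4 n.+1) :
  perm_eq [seq val (val d ord_max) | d : av_1_23_4 n.+2 in children av_tree c]
          (iota 0 (num_sites (val c))).
Proof.
apply: uniq_perm; last 1 first.
- move=> a; rewrite mem_iota add0n /=; apply/imageP/idP => [[d]|aA].
    rewrite inE => /eqP /av_parentE dE ->.
    by rewrite -rcons_perm_avoids -dE (valP d).
  have an : a < n.+2 by exact: leq_trans aA (num_sites_max _).
  have avd : ~~ contains_1_23_4 (rcons_perm (Ordinal an) (val c)).
    by rewrite rcons_perm_avoids.
  exists (av_intro avd); last by rewrite /= rcons_perm_max.
  by rewrite inE; apply/eqP/val_inj; rewrite /= rcons_permK.
- rewrite map_inj_in_uniq ?enum_uniq // => d e; rewrite !mem_enum !inE.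
  move=> /eqP /av_parentE dE /eqP /av_parentE eE /val_inj de.
  by apply: val_inj; rewrite dE eE de.
exact: iota_uniq.
Qed.

Lemma av_label_child n (c : av_1_23_4 n.+1) (d : av_1_23_4 n.+2) :
  av_parent d = c ->
  av_label d =
    ((val d ord_max).+1,
     (if 0 < val c ord_max < val d ord_max then (val d ord_max).+1
      else (num_sites (val c)).+1) - (val d ord_max).+1).
Proof.
move=> /av_parentE dE; rewrite /av_label; congr (_, _ - _).
rewrite {1}dE num_sites_rcons // -rcons_perm_avoids -dE; exact: (valP d).
Qed.

(** The productions of (l + 1, A - l - 1) list the labels of the children in
    increasing order of last value. *)
Lemma productions_1_23_4E l A : l < A ->
  productions_1_23_4 (l.+1, A - l.+1) =
    [seq (a.+1, (if 0 < l < a then a.+1 else A.+1) - a.+1) | a <- iota 0 A].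
Proof.
have shift1 (f : nat -> nat * nat) m :
    [seq f i | i <- iota 1 m] = [seq f a.+1 | a <- iota 0 m].
  by rewrite (iotaDl 1 0) -map_comp.
move=> lA; rewrite /productions_1_23_4 eqSS; case: l lA => [|l] lA.
  rewrite eqxx shift1 subnSK // subn0; apply: eq_map => a /=.
  by congr (_, _); lia.
have eA : A = l.+2 + (A - l.+2) by rewrite subnKC.
rewrite [in iota 0 A]eA iotaD map_cat !shift1; congr (_ ++ _).
  apply/eq_in_map => a; rewrite mem_iota add0n => /andP[_ al].
  by rewrite ifF; first congr (_, _); lia.
rewrite add0n -[in iota l.+2 _](addn0 l.+2) iotaDl -map_comp addn0.
apply: eq_map => i; rewrite /= ifT; last by lia.
by congr (_, _); lia.
Qed.

Theorem proposition25 : grows_according_to Av_1_23_4 Omega_1_23_4.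
Proof.
exists av_tree, av_label; split=> [root | n c].
  rewrite /av_label (ord1 (_ ord_max)) /= (@num_sites_uniq _ _ 2) // => b b1.
  by rewrite (negPf (has_1_23_below_small _ b1)); lia.
rewrite [productions _ _](productions_1_23_4E (last_lt_num_sites (valP c))).
set F := fun a : nat => _.
have -> : [seq av_label d | d : av_1_23_4 n.+2 in children av_tree c] =
    [seq F a | a <- [seq val (val d ord_max) | d : av_1_23_4 n.+2 in children av_tree c]].
  rewrite -map_comp; apply/eq_in_map => d; rewrite mem_enum inE => /eqP.
  exact: av_label_child.
exact/perm_map/perm_last_children.
Qed.
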